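(* Let $p\geqslant1$ and let $F\in\mathcal C^\infty(\mathbb R^p)$ be an even potential with bounded Hessian. Assume that $\nabla^2F\geqslant\kappa I_p$ for some $\kappa>0$. Let $N\geqslant2$, let $$U(x)=\sum_{i=1}^{N-1}F(x_i-x_{i+1}),\qquad x=(x_1,\dots,x_N)\in(\mathbb R^p)^N,$$ and let $U^c(x)=U(Q^Tx)$ for $x\in\mathbb R^{p(N-1)}$, where $Q$ is a real $p(N-1)\times pN$ matrix as described in the context. Then $U^c$ satisfies $$\forall x\in\mathbb R^{p(N-1)},\qquad\lambda I_{p(N-1)}\leqslant\nabla^2U^c(x)\leqslant\Lambda I_{p(N-1)}$$ with $\lambda=\kappa/N^2$ and $\Lambda=4\|\nabla^2F\|_\infty$. As a consequence, if $\gamma\geqslant2\sqrt\Lambda$, then for all $N\geqslant 2$ the drift of the centered process $$\mathrm dX^c_t=Y^c_t\,\mathrm dt,\qquad\mathrm dY^c_t=-Q\nabla U(Q^TX^c_t)\,\mathrm dt-\gamma Y^c_t\,\mathrm dt+\tilde\Sigma\,\mathrm d\tilde W_t$$ on $\mathbb R^{p(N-1)}\times\mathbb R^{p(N-1)}$ satisfies $\mathrm{Cont}_R(M,\rho)$ with $\rho=\kappa/(3\gamma N^2)$ and a symmetric positive definite $2p(N-1)\times2p(N-1)$ matrix $M$ which satisfies $\frac12\min(1,\Lambda^{-1})I_{2p(N-1)}\leqslant M\leqslant\frac32\max(1,\Lambda^{-1})I_{2p(N-1)}$.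
   Context: Let $\Pi$ be the orthogonal projector of $(\mathbb R^p)^N$ given by $\Pi x=(x_1-\bar x,\dots,x_N-\bar x)$ with $\bar x=N^{-1}\sum_{i=1}^Nx_i$. $Q$ is a real $p(N-1)\times pN$ matrix with $\mathrm{Ker}\,Q=\mathrm{Ker}\,\Pi$ and such that the restriction of $Q$ to the image of $\Pi$ is a linear isometry onto $\mathbb R^{p(N-1)}$ (so that the restriction of $Q^TQ$ to $\mathrm{Im}\,\Pi$ is the identity). $\tilde\Sigma$ is a constant matrix and $\tilde W$ a standard Brownian motion on $\mathbb R^{p(N-1)}$. (The process $(X^c,Y^c)=(QX,QY)$ describes, seen from its center of mass, the unpinned chain of oscillators $\mathrm dX_{i,t}=Y_{i,t}\mathrm dt$, $\mathrm dY_{i,t}=-\nabla_{x_i}U(X_t)\mathrm dt-\gamma Y_{i,t}\mathrm dt+\sqrt{2\gamma T_i}\,\mathrm dW_{i,t}$, $1\leqslant i\leqslant N$, with $T_i\geqslant 0$.) The drift of the centered process is $b(x,y)=(y,\,-\nabla U^c(x)-\gamma y)$, since $Q\nabla U(Q^Tx)=\nabla U^c(x)$. $\|\nabla^2F\|_\infty$ is the supremum over $\mathbb R^p$ of the operator norm of the Hessian of $F$. For real square matrices, not necessarily symmetric, $A\leqslant B$ means $u\cdot Au\leqslant u\cdot Bu$ for all vectors $u$. For a smooth map $b:\mathbb R^d\to\mathbb R^d$ with Jacobian matrix $J_b(z)=(\partial_{z_j}b_i(z))_{1\leqslant i,j\leqslant d}$, a real symmetric positive definite $d\times d$ matrix $M$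 and $\rho\in\mathbb R$, the condition $\mathrm{Cont}_R(M,\rho)$ means: $MJ_b(z)\leqslant-\rho M$ for all $z\in\mathbb R^d$. *)

(* Defs.v *)
(* R : realType is the field of real numbers; vectors are columns. *)
From HB Require Import structures.
From mathcomp Require Export all_boot all_order all_algebra.
From mathcomp Require Export boolp classical_sets functions reals.
From mathcomp Require Export topology normedtype derive.

Set Implicit Arguments.
Unset Strict Implicit.
Unset Printing Implicit Defensive.

Import Order.TTheory GRing.Theory Num.Theory.
Export numFieldNormedType.Exports.

Local Open Scope classical_set_scope.
Local Open Scope ring_scope.

(* The norm `|u| of the library is the sup norm, hence a separate Euclidean
   norm.  The notions 'D_v f and differentiable do not depend on the choice. *)
Definition dot (R : realType) n (u v : 'cV[R]_n) : R := (u^T *m v) 0 0.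

Definition enorm (R : realType) n (u : 'cV[R]_n) : R := Num.sqrt (dot u u).

Definition opnorm (R : realType) m n (A : 'M[R]_(m, n)) : R :=
  sup [set enorm (A *m u) | u in [set u : 'cV[R]_n | enorm u <= 1]].

(* A <= B as quadratic forms; neither matrix needs to be symmetric. *)
Definition mxle (R : realType) n (A B : 'M[R]_n) : Prop :=
  forall u : 'cV[R]_n, dot u (A *m u) <= dot u (B *m u).

Definition sym_posdef (R : realType) n (M : 'M[R]_n) : Prop :=
  M^T = M /\ forall u : 'cV[R]_n, u != 0 -> 0 < dot u (M *m u).

Definition basis_vec (R : realType) n (i : 'I_n) : 'cV[R]_n := delta_mx i 0.

(* C^infinity: iterated directional derivatives of every order are (Frechet)
   differentiable, hence continuous, everywhere. *)
Definition smooth (R : realType) n (f : 'cV[R]_n -> R) : Prop :=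
  forall (vs : seq 'cV[R]_n) (x : 'cV[R]_n),
    differentiable (foldr (fun v (g : 'cV[R]_n -> R) => 'D_v g) f vs) x.

Definition grad (R : realType) n (f : 'cV[R]_n -> R) (x : 'cV[R]_n) : 'cV[R]_n :=
  \col_i 'D_(basis_vec R i) f x.

Definition hess (R : realType) n (f : 'cV[R]_n -> R) (x : 'cV[R]_n) : 'M[R]_n :=
  \matrix_(i, j) 'D_(basis_vec R i) ('D_(basis_vec R j) f) x.

(* Row i holds the partial derivatives of b_i; the library's 'J acts on row
   vectors and is the transpose of this matrix. *)
Definition jac (R : realType) n (b : 'cV[R]_n -> 'cV[R]_n) (z : 'cV[R]_n) :
    'M[R]_n :=
  \matrix_(i, j) 'D_(basis_vec R j) (fun z' => b z' i 0) z.

Definition bounded_hess (R : realType) n (f : 'cV[R]_n -> R) : Prop :=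
  has_ubound (range (fun x => opnorm (hess f x))).

(* Real-valued supremum: meaningful under bounded_hess. *)
Definition hess_norm (R : realType) n (f : 'cV[R]_n -> R) : R :=
  sup (range (fun x => opnorm (hess f x))).

Definition ContR (R : realType) n (b : 'cV[R]_n -> 'cV[R]_n) (M : 'M[R]_n)
    (rho : R) : Prop :=
  forall z, mxle (M *m jac b z) (- (rho *: M)).

(* (R^p)^N is identified with 'cV_(N * p), block after block: x_i is blk x i,
   and flat is the inverse identification. *)
Definition blk (R : realType) N p (x : 'cV[R]_(N * p)) (i : 'I_N) : 'cV[R]_p :=
  (row i (vec_mx x^T))^T.

Definition flat (R : realType) N p (f : 'I_N -> 'cV[R]_p) : 'cV[R]_(N * p) :=
  (mxvec (\matrix_(i < N) (f i)^T))^T.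

Definition barycenter (R : realType) N p (x : 'cV[R]_(N * p)) : 'cV[R]_p :=
  N%:R^-1 *: \sum_(i < N) blk x i.

Definition Pi (R : realType) N p (x : 'cV[R]_(N * p)) : 'cV[R]_(N * p) :=
  flat (fun i => blk x i - barycenter x).

Record centering_matrix (R : realType) N p (Q : 'M[R]_(N.-1 * p, N * p)) :
    Prop := CenteringMatrix {
  centering_ker : forall x : 'cV[R]_(N * p), Q *m x = 0 <-> Pi x = 0 ;
  centering_isometry :
    forall x : 'cV[R]_(N * p), range (@Pi R N p) x -> enorm (Q *m x) = enorm x ;
  centering_onto :
    forall y : 'cV[R]_(N.-1 * p), exists2 x, range (@Pi R N p) x & Q *m x = y
}.

(* The sum runs over the pairs (i, i + 1) of consecutive sites. *)
Definition chain_potential (R : realType) N p (F : 'cV[R]_p -> R)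
    (x : 'cV[R]_(N * p)) : R :=
  \sum_(i < N) \sum_(j < N | j == i.+1 :> nat) F (blk x i - blk x j).

Definition centered_potential (R : realType) N p (F : 'cV[R]_p -> R)
    (Q : 'M[R]_(N.-1 * p, N * p)) (x : 'cV[R]_(N.-1 * p)) : R :=
  chain_potential F (Q^T *m x).

(* The point z = (x, y) of the phase space is col_mx x y. *)
Definition centered_drift (R : realType) N p (F : 'cV[R]_p -> R)
    (Q : 'M[R]_(N.-1 * p, N * p)) (gamma : R)
    (z : 'cV[R]_(N.-1 * p + N.-1 * p)) : 'cV[R]_(N.-1 * p + N.-1 * p) :=
  let x := usubmx z in let y := dsubmx z in
  col_mx y (- (Q *m grad (@chain_potential R N p F) (Q^T *m x)) - gamma *: y).

(* Main.v *)
Require Import Defs.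
From HB Require Import structures.
From mathcomp Require Import landau ring lra.
Set Implicit Arguments.
Unset Strict Implicit.
Unset Printing Implicit Defensive.
Import Order.TTheory GRing.Theory Num.Theory.
Local Open Scope classical_set_scope.
Local Open Scope ring_scope.

(* Since Q^T is an isometry of R^{p(N-1)} onto Im Pi, the Hessian of U^c is that
   of U restricted to mean-zero configurations, i.e. the sum over the links of
   (u_i - u_{i+1}) . H_i (u_i - u_{i+1}) with kappa <= H_i <= ||hess F||; the
   bounds follow from a discrete Poincare inequality and from
   |a - b|^2 <= 2 |a|^2 + 2 |b|^2.
   The contraction holds for M = [[1, 1/gamma], [1/gamma, 1/Lambda]]: the x.y
   term of M J_b cancels, and the remaining term y.Hx / Lambda is absorbed
   thanks to |Hx|^2 <= Lambda x.Hx, which uses the symmetry of the Hessian. *)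

(** * Symmetry of second derivatives *)

Section LineDerivatives.
Variables (R : realType) (V W : normedModType R).

(** Derivatives along a line depend only on the restriction to that line, so [f] and [g] may live on
    different spaces; this carries derivatives through linear maps. *)
Lemma eq_line_quotient (f : V -> R) (g : W -> R) (a v : V) (b w : W) :
  (forall h : R, f (h *: v + a) = g (h *: w + b)) ->
  (fun h => h^-1 *: ((f \o shift a) (h *: v) - f a)) =
  (fun h => h^-1 *: ((g \o shift b) (h *: w) - g b)).
Proof.
move=> E; apply/funext => h /=; rewrite E.
by have := E 0; rewrite !scale0r !add0r => ->.
Qed.

Lemma eq_line_derive (f : V -> R) (g : W -> R) (a v : V) (b w : W) :
  (forall h : R, f (h *: v + a) = g (h *: w + b)) -> 'D_v f a = 'D_w g b.
Proof. by move=> E; rewrite /derive (eq_line_quotient E). Qed.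

Lemma eq_line_derivable (f : V -> R) (g : W -> R) (a v : V) (b w : W) :
  (forall h : R, f (h *: v + a) = g (h *: w + b)) ->
  derivable g b w -> derivable f a v.
Proof. by move=> E; rewrite /derivable (eq_line_quotient E). Qed.
End LineDerivatives.

Section MixedDerivatives.
Variables (R : realType) (V : normedModType R).
Implicit Types (f : V -> R) (u v x : V).

Lemma is_derive_line f y u (s : R) : differentiable f (s *: u + y) ->
  is_derive s 1 (fun s : R => f (s *: u + y)) ('D_u f (s *: u + y)).
Proof.
move=> df.
have E (h : R) : f ((h *: (1 : R) + s) *: u + y) = f (h *: u + (s *: u + y)).
  by rewrite [_ *: 1]mulr1 scalerDl addrA.
apply: DeriveDef; last exact: eq_line_derive E.
by apply: eq_line_derivable E _; exact: diff_derivable.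
Qed.

(** The mean value theorem in the direction [u], followed by the first-order expansion of ['D_u f]
    at [x]; second derivatives away from [x] never enter. *)
Lemma second_difference f x u v :
  (forall y, differentiable f y) -> differentiable ('D_u f) x ->
  forall e : R, 0 < e -> exists2 d : R, 0 < d & forall t : R, 0 < t -> t < d ->
    `|f (t *: u + (t *: v + x)) - f (t *: u + x) - f (t *: v + x) + f x
      - t ^+ 2 * 'D_v ('D_u f) x| <= e * t ^+ 2.
Proof.
move=> df ddf e e0.
(* For [0 <= s <= t] the displacements [s *: u + t *: v] and [s *: u] have norm at most [t * c]; two
   errors of size [e / (2 * c) * (t * c)] then add up to [e * t]. *)
pose c : R := `|u| + `|v| + 1.
have c0 : 0 < c by rewrite ltr_wpDl ?addr_ge0.
have e'0 : 0 < e / (2 * c) by rewrite divr_gt0 ?mulr_gt0.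
pose D (y : V) : R := 'D_u f y; pose q : R := 'D_v ('D_u f) x.
pose L (h : V) : R := 'd ('D_u f) x h.
have [d d0 Hd] : exists2 d : R, 0 < d & forall h, `|h| < d ->
   `|D (h + x) - D x - L h| <= e / (2 * c) * `|h|.
  have [_ /eqaddoP/(_ _ e'0)] := (diff_locallyP _ _).1 ddf.
  move=> /nbhs_ballP[d d0 Hd]; exists d => // h hd.
  have := Hd h; rewrite -ball_normE /ball_ /= sub0r normrN => /(_ hd).
  by rewrite opprD addrA.
have LE s t : L (s *: u + t *: v) = L (s *: u) + t * q.
  by rewrite /L /q linearD (linearZ_LR _ t v) /= -(deriveE v ddf).
exists (d / c); first by rewrite divr_gt0.
move=> t t0; rewrite ltr_pdivlMr// => tc.
pose phi (s : R) : R := f (s *: u + (t *: v + x)) - f (s *: u + x).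
pose dphi (s : R) : R := D (s *: u + (t *: v + x)) - D (s *: u + x).
have dP (s : R) : is_derive s (1 : R) phi (dphi s).
  by apply: is_deriveB; apply: is_derive_line.
have [|s sP Hs] := @MVT R phi dphi 0 t t0 (fun s _ => dP s).
  by apply: derivable_within_continuous => s _; exact: ex_derive.
have s0 : 0 <= s by rewrite ltW// (itvP sP).
have st : s <= t by rewrite ltW// (itvP sP).
move: Hs; rewrite /phi subr0 !scale0r !add0r => Hs.
rewrite -/q (_ : _ + f x = dphi s * t); last by rewrite -Hs; ring.
have su : `|s *: u| <= t * `|u| by rewrite normrZ ger0_norm// ler_wpM2r.
have tv : `|t *: v| <= t * `|v| by rewrite normrZ gtr0_norm.
have B1 : `|s *: u + t *: v| <= t * c.
  by rewrite (le_trans (ler_normD _ _))// /c; lra.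
have B2 : `|s *: u| <= t * c.
  rewrite (le_trans su)// ler_pM2l// /c.
  by have := normr_ge0 v; lra.
have := Hd _ (le_lt_trans B1 tc); have := Hd _ (le_lt_trans B2 tc).
rewrite LE -(addrA (s *: u)) => H2 H1.
have {}H1 := le_trans H1 (ler_wpM2l (ltW e'0) B1).
have {}H2 := le_trans H2 (ler_wpM2l (ltW e'0) B2).
have E : e / (2 * c) * (t * c) = e * t / 2 by field; rewrite gt_eqF.
have -> : dphi s * t - t ^+ 2 * q = t * (dphi s - t * q) by ring.
rewrite normrM (gtr0_norm t0).
have -> : e * t ^+ 2 = t * (e * t) by ring.
rewrite E in H1 H2; rewrite ler_pM2l// /dphi.
move: H1 H2; rewrite !ler_norml => /andP[? ?] /andP[? ?].
by apply/andP; split; lra.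
Qed.

(** The second difference is symmetric in [u] and [v], so after division by [t ^+ 2] it approaches
    both mixed derivatives. *)
Lemma derive_comm f x u v :
  (forall y, differentiable f y) ->
  differentiable ('D_u f) x -> differentiable ('D_v f) x ->
  'D_u ('D_v f) x = 'D_v ('D_u f) x.
Proof.
move=> df du dv; apply/eqP; rewrite -subr_eq0 -normr_le0.
apply/ler_addgt0Pl => e e0; rewrite addr0.
have e20 : 0 < e / 2 by rewrite divr_gt0.
have [d1 d10 H1] := second_difference v df du e20.
have [d2 d20 H2] := second_difference u df dv e20.
pose t := Num.min d1 d2 / 2.
have m0 : 0 < Num.min d1 d2 by rewrite lt_min d10.
have t0 : 0 < t by rewrite divr_gt0.
have tm : t < Num.min d1 d2 by rewrite /t; lra.
have aux (a b b' z A B r s : R) : `|a - b - b' + z - s * A| <= r / 2 * s ->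
    `|a - b' - b + z - s * B| <= r / 2 * s -> `|s * (B - A)| <= s * r.
  by rewrite !ler_norml => /andP[? ?] /andP[? ?]; apply/andP; split; lra.
move: tm; rewrite lt_min => /andP[/(H1 _ t0) {}H1 /(H2 _ t0) {}H2].
have t20 : 0 < t ^+ 2 by rewrite exprn_gt0.
rewrite -(ler_pM2l t20) -{1}(gtr0_norm t20) -normrM.
by apply: aux H1 _; rewrite [t *: u + _]addrCA.
Qed.
End MixedDerivatives.

(** * Euclidean norm and quadratic forms *)

Section DotProduct.
Variable R : realType.
Implicit Type n : nat.

Lemma dot_sum n (u v : 'cV[R]_n) : dot u v = \sum_i u i 0 * v i 0.
Proof. by rewrite /dot mxE; apply: eq_bigr => i _; rewrite mxE. Qed.

Lemma dotC n (u v : 'cV[R]_n) : dot u v = dot v u.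
Proof. by rewrite !dot_sum; apply: eq_bigr => i _; rewrite mulrC. Qed.

Lemma dotDr n (u v w : 'cV[R]_n) : dot u (v + w) = dot u v + dot u w.
Proof. by rewrite /dot mulmxDr mxE. Qed.

Lemma dotDl n (u v w : 'cV[R]_n) : dot (v + w) u = dot v u + dot w u.
Proof. by rewrite !(dotC _ u) dotDr. Qed.

Lemma dotZr n (u v : 'cV[R]_n) a : dot u (a *: v) = a * dot u v.
Proof. by rewrite /dot -scalemxAr mxE. Qed.

Lemma dotZl n (u v : 'cV[R]_n) a : dot (a *: v) u = a * dot v u.
Proof. by rewrite !(dotC _ u) dotZr. Qed.

Lemma dotNr n (u v : 'cV[R]_n) : dot u (- v) = - dot u v.
Proof. by rewrite -scaleN1r dotZr mulN1r. Qed.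

Lemma dotNl n (u v : 'cV[R]_n) : dot (- v) u = - dot v u.
Proof. by rewrite !(dotC _ u) dotNr. Qed.

Lemma dot0r n (u : 'cV[R]_n) : dot u 0 = 0.
Proof. by rewrite /dot mulmx0 mxE. Qed.

Definition dotE := (dotDl, dotDr, dotNl, dotNr, dotZl, dotZr).

Lemma dot_sumr n (I : Type) (r : seq I) (P : pred I) (u : 'cV[R]_n) f :
  dot u (\sum_(i <- r | P i) f i) = \sum_(i <- r | P i) dot u (f i).
Proof. by rewrite /dot mulmx_sumr summxE. Qed.

Lemma dot_mulmx m n (A : 'M[R]_(m, n)) u v : dot u (A *m v) = dot (A^T *m u) v.
Proof. by rewrite /dot trmx_mul trmxK mulmxA. Qed.

Lemma dot_scalar_mx n (u : 'cV[R]_n) a : dot u (a%:M *m u) = a * dot u u.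
Proof. by rewrite mul_scalar_mx dotZr. Qed.

Lemma dot_ge0 n (u : 'cV[R]_n) : 0 <= dot u u.
Proof. by rewrite dot_sum sumr_ge0// => i _; rewrite -expr2 sqr_ge0. Qed.

Lemma dot_polarization n (u v : 'cV[R]_n) :
  dot u v = (dot (u + v) (u + v) - dot u u - dot v v) / 2.
Proof. by rewrite !dotE (dotC v u); field. Qed.

Lemma dot_eq0 n (u : 'cV[R]_n) : dot u u = 0 -> u = 0.
Proof.
rewrite dot_sum => /eqP; rewrite psumr_eq0 => [/allP u0|i _]; last first.
  by rewrite -expr2 sqr_ge0.
apply/colP => i; rewrite mxE; apply/eqP.
by have := u0 i; rewrite mem_index_enum -expr2 sqrf_eq0 => /(_ isT).
Qed.

Lemma dot_gt0 n (u : 'cV[R]_n) : u != 0 -> 0 < dot u u.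
Proof.
move=> u0; rewrite lt_neqAle dot_ge0 andbT eq_sym.
by apply: contra u0 => /eqP/dot_eq0/eqP.
Qed.

Lemma dot_inj n (u v : 'cV[R]_n) : (forall w, dot u w = dot v w) -> u = v.
Proof.
move=> E; apply/eqP; rewrite -subr_eq0; apply/eqP/dot_eq0.
by rewrite dotDl dotNl E subrr.
Qed.

Lemma dot_cauchy n (u v : 'cV[R]_n) : dot u v ^+ 2 <= dot u u * dot v v.
Proof.
have [->|/dot_gt0 v0] := eqVneq v 0; first by rewrite !dot0r expr0n mulr0.
(* With [a = dot u v] and [b = dot v v], the square of [b u - a v] factors as [b] times the gap in
   the inequality. *)
have := dot_ge0 (dot v v *: u - dot u v *: v); rewrite !dotE (dotC v u).
set a := dot u v; set b := dot v v; set c := dot u u.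
rewrite (_ : _ + _ = b * (c * b - a ^+ 2)); last by rewrite /a /b /c; ring.
by rewrite pmulr_rge0// subr_ge0.
Qed.

Lemma sqr_enorm n (u : 'cV[R]_n) : enorm u ^+ 2 = dot u u.
Proof. by rewrite sqr_sqrtr ?dot_ge0. Qed.

Lemma enorm_ge0 n (u : 'cV[R]_n) : 0 <= enorm u.
Proof. exact: sqrtr_ge0. Qed.

Lemma dot_le_enorm n (u v : 'cV[R]_n) : dot u v <= enorm u * enorm v.
Proof.
rewrite /enorm -sqrtrM ?dot_ge0// (le_trans (ler_norm _))// -sqrtr_sqr.
by rewrite ler_wsqrtr// dot_cauchy.
Qed.

(** The Frobenius norm is an upper bound, so the [sup] in [opnorm] is a genuine supremum. *)
Lemma has_ubound_opnorm m n (A : 'M[R]_(m, n)) :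
  has_ubound [set enorm (A *m u) | u in [set u : 'cV[R]_n | enorm u <= 1]].
Proof.
exists (Num.sqrt (\sum_i dot (row i A)^T (row i A)^T)) => _ [u /= u1 <-].
rewrite ler_wsqrtr// dot_sum ler_sum// => i _.
have -> : (A *m u) i 0 = dot (row i A)^T u.
  by rewrite /dot trmxK -row_mul [RHS]mxE.
rewrite -expr2 (le_trans (dot_cauchy _ _))// ler_piMr ?dot_ge0//.
by rewrite -sqr_enorm expr_le1// enorm_ge0.
Qed.

Lemma dot_le_opnorm n (A : 'M[R]_n) u : dot u (A *m u) <= opnorm A * dot u u.
Proof.
have [->|u0] := eqVneq u 0; first by rewrite mulmx0 !dot0r mulr0.
have e0 : 0 < enorm u by rewrite sqrtr_gt0 dot_gt0.
have [w uE w1] : exists2 w, u = enorm u *: w & enorm w = 1.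
  exists ((enorm u)^-1 *: u); first by rewrite scalerA mulfV ?gt_eqF// scale1r.
  by rewrite [LHS]/enorm !dotE -sqr_enorm expr2 mulKf ?mulVf ?sqrtr1 ?gt_eqF.
rewrite -(sqr_enorm u) {1 2}uE -scalemxAr !dotE mulrA -expr2 mulrC.
rewrite ler_wpM2r ?sqr_ge0// (le_trans (dot_le_enorm _ _))// w1 mul1r.
apply: sup_upper_bound; last by exists w => //=; rewrite w1.
split; last exact: has_ubound_opnorm.
by exists (enorm (A *m w)), w => //=; rewrite w1.
Qed.

(* A positive semidefinite form is tested on [u - Lambda^-1 H u]. *)
Lemma dot_mulmx_le n (H : 'M[R]_n) (Lambda : R) u : H^T = H -> 0 < Lambda ->
  mxle 0%:M H -> mxle H Lambda%:M ->
  dot (H *m u) (H *m u) <= Lambda * dot u (H *m u).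
Proof.
move=> Hs L0 H0 HL; pose t := Lambda^-1.
have := H0 (u - t *: (H *m u)); rewrite dot_scalar_mx mul0r.
have := HL (H *m u); rewrite dot_scalar_mx mulmxBr -scalemxAr.
rewrite !dotE (dot_mulmx H u (H *m u)) Hs.
set a := dot (H *m u) (H *m u); set b := dot u _; set c := dot (H *m u) _.
move=> c_le ge0; have t0 : 0 < t by rewrite invr_gt0.
have : t * (t * c) <= t * a by rewrite ler_pM2l// ler_pdivrMl.
by move=> ?; rewrite -ler_pdivrMl// -/t; lra.
Qed.
End DotProduct.

(** * Smooth functions of column vectors *)

Section ColumnVectors.
Variable R : realType.

Lemma col_sum_basis n (v : 'cV[R]_n) : v = \sum_i v i 0 *: basis_vec R i.
Proof.
by rewrite [LHS]matrix_sum_delta; apply: eq_bigr => i _; rewrite big_ord1.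
Qed.

(** A linear map on columns is a finite sum of coordinates times fixed vectors, and coordinates are
    differentiable. *)
Lemma linear_col_differentiable n (W : normedModType R)
  (L : {linear 'cV[R]_n -> W}) x : differentiable L x.
Proof.
have -> : (L : 'cV[R]_n -> W) =
    \sum_(i < n) (fun y : 'cV[R]_n => y i 0 *: L (basis_vec R i)).
  apply/funext => y; rewrite {1}[y]col_sum_basis linear_sum fct_sumE.
  by apply: eq_bigr => i _; rewrite linearZ.
apply: differentiable_sum => i; apply: differentiableZl.
exact: differentiable_coord.
Qed.

Lemma derive_sum_basis n (W : normedModType R) (f : 'cV[R]_n -> W) x v :
  differentiable f x -> 'D_v f x = \sum_i v i 0 *: 'D_(basis_vec R i) f x.
Proof.
move=> df; rewrite deriveE// {1}[v]col_sum_basis linear_sum.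
by apply: eq_bigr => i _; rewrite linearZ deriveE.
Qed.

Lemma derive_comp_linear m n (f : 'cV[R]_n -> R)
    (L : {linear 'cV[R]_m -> 'cV[R]_n}) v x :
  'D_v (f \o L) x = 'D_(L v) f (L x).
Proof. by apply: eq_line_derive => h /=; rewrite linearD linearZ. Qed.

Lemma derive_comp_linear_fun m n (f : 'cV[R]_n -> R)
  (L : {linear 'cV[R]_m -> 'cV[R]_n}) v : 'D_v (f \o L) = 'D_(L v) f \o L.
Proof. by apply/funext => x; exact: derive_comp_linear. Qed.

Lemma is_derive_coord n (k : 'I_n) (x v : 'cV[R]_n) :
  is_derive x v (fun y : 'cV[R]_n => y k 0) (v k 0).
Proof.
pose f (y : 'cV[R]_n) : R := y k 0.
have E (h : R) : f (h *: v + x) = id (h *: v k 0 + x k 0) by rewrite /f !mxE.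
split.
  apply: (@eq_line_derivable _ _ _ f (@id R) x v (x k 0) (v k 0) E).
  exact: derivable_id.
rewrite (@eq_line_derive _ _ _ f (@id R) x v (x k 0) (v k 0) E).
exact: derive_id.
Qed.

Lemma smooth_differentiable n (f : 'cV[R]_n -> R) x :
  smooth f -> differentiable f x.
Proof. by move=> /(_ [::]); apply. Qed.

(** [foldr] applies the last direction of the list first, hence the use of [rcons]. *)
Lemma smooth_derive n (f : 'cV[R]_n -> R) v : smooth f -> smooth ('D_v f).
Proof. by move=> sf vs x; have := sf (rcons vs v) x; rewrite foldr_rcons. Qed.

(** Every iterated derivative of [f \o L] is again some [g \o L] with [g] smooth; this invariant
    carries the induction on the directions. *)
Lemma smooth_comp_linear m n (f : 'cV[R]_n -> R)
  (L : {linear 'cV[R]_m -> 'cV[R]_n}) : smooth f -> smooth (f \o L).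
Proof.
move=> sf vs; suff [g sg ->] : exists2 g : 'cV[R]_n -> R, smooth g &
    foldr (fun v (g : 'cV[R]_m -> R) => 'D_v g) (f \o L) vs = g \o L.
  move=> x; apply: differentiable_comp; first exact: linear_col_differentiable.
  exact: smooth_differentiable.
elim: vs => [|v vs [g sg /= ->]]; first by exists f.
by exists ('D_(L v) g); [exact: smooth_derive|exact: derive_comp_linear_fun].
Qed.

Lemma derive_bigsum n (I : Type) (r : seq I) (P : pred I)
    (f : I -> 'cV[R]_n -> R) v x : (forall i, smooth (f i)) ->
  'D_v (\sum_(i <- r | P i) f i) x = \sum_(i <- r | P i) 'D_v (f i) x.
Proof.
move=> sf; suff [] : is_derive x v (\sum_(i <- r | P i) f i)
    (\sum_(i <- r | P i) 'D_v (f i) x) by [].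
elim/big_rec2: _ => [|i d g _ dg]; first exact: is_derive_cst.
apply: is_deriveD => //; apply: derivableP; apply: diff_derivable.
exact: smooth_differentiable.
Qed.

Lemma derive_bigsum_fun n (I : Type) (r : seq I) (P : pred I)
    (f : I -> 'cV[R]_n -> R) v : (forall i, smooth (f i)) ->
  'D_v (\sum_(i <- r | P i) f i) = \sum_(i <- r | P i) 'D_v (f i).
Proof.
move=> sf; apply/funext => x.
by rewrite derive_bigsum// (fct_sumE _ _ (fun i => 'D_v (f i))).
Qed.

Lemma smooth_bigsum n (I : Type) (r : seq I) (P : pred I)
    (f : I -> 'cV[R]_n -> R) : (forall i, smooth (f i)) ->
  smooth (\sum_(i <- r | P i) f i).
Proof.
move=> sf vs; suff [g sg ->] : exists2 g : I -> 'cV[R]_n -> R,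
    (forall i, smooth (g i)) &
    foldr (fun v (g : 'cV[R]_n -> R) => 'D_v g) (\sum_(i <- r | P i) f i) vs
      = \sum_(i <- r | P i) g i.
  move=> x; elim/big_rec: _ => [|i h _ dh]; first exact: differentiable_cst.
  by apply: differentiableD => //; exact: smooth_differentiable.
elim: vs => [|v vs [g sg /= ->]]; first by exists f.
exists (fun i => 'D_v (g i)); first by move=> i; exact: smooth_derive.
exact: derive_bigsum_fun.
Qed.

(** Bridge from matrices to iterated directional derivatives, through which the Hessian forms below
    are computed without coordinates. *)
Lemma dot_hess n (f : 'cV[R]_n -> R) x u v : smooth f ->
  dot u (hess f x *m v) = 'D_u ('D_v f) x.
Proof.
move=> sf; have sD w := smooth_derive w sf.
rewrite (derive_sum_basis _ (smooth_differentiable _ (sD v))) dot_sum.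
apply: eq_bigr => i _; congr (_ * _).
rewrite -[LHS](_ :
  'D_(basis_vec R i) (\sum_j v j 0 *: 'D_(basis_vec R j) f) x = _).
  congr ('D_ _ _ _); apply/funext => y; rewrite fct_sumE.
  by rewrite (derive_sum_basis _ (smooth_differentiable _ sf)).
have dD w y z : derivable ('D_w f) y z.
  by apply: diff_derivable; exact: smooth_differentiable.
rewrite derive_sum => [|j]; last exact: derivableZ.
by rewrite mxE; apply: eq_bigr => j _; rewrite deriveZ// mxE mulrC.
Qed.

Lemma hess_sym n (f : 'cV[R]_n -> R) x : smooth f -> (hess f x)^T = hess f x.
Proof.
move=> sf; apply/matrixP => i j; rewrite !mxE; apply: derive_comm => [y||];
  apply: smooth_differentiable => //; exact: smooth_derive.
Qed.

End ColumnVectors.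

(** * Chains, blocks and centering matrices *)

Section Chain.
Variable R : realType.

(** The last site has no successor, so [n.+1] sites carry [n] links. *)
Lemma sum_consecutive n (G : 'I_n.+1 -> 'I_n.+1 -> R) :
  \sum_(i < n.+1) \sum_(j < n.+1 | j == i.+1 :> nat) G i j =
  \sum_(k < n) G (widen_ord (leqnSn n) k) (lift ord0 k).
Proof.
rewrite big_ord_recr /= [X in _ + X]big_pred0 ?addr0 => [|j]; last first.
  by apply/negbTE; rewrite neq_ltn ltn_ord.
by apply: eq_bigr => k _; rewrite (big_pred1 (lift ord0 k)).
Qed.

Lemma sqr_sum_le n (d : 'I_n -> R) :
  (\sum_i d i) ^+ 2 <= n%:R * \sum_i d i ^+ 2.
Proof.
have := dot_cauchy (const_mx 1 : 'cV[R]_n) (\col_i d i); rewrite !dot_sum.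
under eq_bigr do rewrite !mxE mul1r.
under [X in _ <= X * _]eq_bigr do rewrite !mxE mul1r.
under [X in _ <= _ * X]eq_bigr do rewrite !mxE -expr2.
by rewrite sumr_const card_ord.
Qed.

(* A mean-zero sequence satisfies [sum a_i^2 <= sum (a_i - a_0)^2]; each
   difference [a_i - a_0] telescopes over at most [n] links. *)
Lemma chain_poincare n (a : 'I_n.+1 -> R) : \sum_i a i = 0 ->
  \sum_i a i ^+ 2 <= n.+1%:R ^+ 2 *
    \sum_(i < n.+1) \sum_(j < n.+1 | j == i.+1 :> nat) (a i - a j) ^+ 2.
Proof.
move=> a0; rewrite sum_consecutive.
(* [inord] extends [a] to natural indices, for telescoping over intervals of [nat]. *)
pose b k := a (inord k); pose D := \sum_(k < n) (b k.+1 - b k) ^+ 2.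
rewrite [X in _ * X](_ : _ = D); last first.
  apply: eq_bigr => k _; rewrite -sqrrN opprB; congr ((a _ - a _) ^+ 2).
    by apply: val_inj; rewrite /= inordK ?ltnS.
  by apply: val_inj; rewrite /= inordK // ltnS ltnW.
(* Cauchy-Schwarz on a telescoping sum of [i <= n.+1] terms gives one factor [n.+1]; the final sum
   over [i] gives the other. *)
have aD i : (a i - a ord0) ^+ 2 <= n.+1%:R * D.
  have -> : a i - a ord0 = \sum_(k < i) (b k.+1 - b k).
    rewrite -(big_mkord xpredT (fun k => b k.+1 - b k)) telescope_sumr//.
    by rewrite /b inord_val; congr (_ - a _); apply: val_inj; rewrite /= inordK.
  rewrite (le_trans (sqr_sum_le _))// ler_pM ?ler_nat ?sumr_ge0//.
  - by move=> k _; rewrite sqr_ge0.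
  - exact: ltnW.
  have ni : (i <= n)%N by rewrite -ltnS.
  rewrite /D -(big_mkord xpredT (fun k => (b k.+1 - b k) ^+ 2)).
  rewrite -(big_mkord xpredT (fun k => (b k.+1 - b k) ^+ 2)).
  by rewrite [leRHS](@big_cat_nat _ _ _ i)//= lerDl sumr_ge0//
    => k _; rewrite sqr_ge0.
have : \sum_i a i ^+ 2 <= \sum_i (a i - a ord0) ^+ 2.
  rewrite [leRHS](eq_bigr
    (fun i => a i ^+ 2 + (a ord0 ^+ 2 - 2 * a ord0 * a i))).
    rewrite big_split/= sumrB -(@mulr_sumr _ _ _ _ a) a0 mulr0 subr0 lerDl.
    by rewrite sumr_ge0// => i _; rewrite sqr_ge0.
  by move=> i _; ring.
move=> /le_trans; apply.
rewrite (le_trans (ler_sum _ (fun i _ => aD i)))//.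
by rewrite sumr_const card_ord -(mulr_natl (_ * D)) mulrA expr2.
Qed.

Lemma chain_poincare_col n p (a : 'I_n -> 'cV[R]_p) : \sum_i a i = 0 ->
  \sum_i dot (a i) (a i) <= n%:R ^+ 2 *
    \sum_(i < n) \sum_(j < n | j == i.+1 :> nat) dot (a i - a j) (a i - a j).
Proof.
case: n a => [|n] a; first by rewrite !big_ord0 mulr0.
move=> a0; under eq_bigr do rewrite dot_sum.
under [X in _ <= _ * X]eq_bigr => i _.
  under eq_bigr do rewrite dot_sum.
  rewrite exchange_big; over.
rewrite exchange_big [X in _ <= _ * X]exchange_big mulr_sumr.
apply: ler_sum => c _; have := @chain_poincare _ (fun i => a i c 0).
rewrite -summxE a0 mxE => /(_ erefl); congr (_ <= _ * _).
by apply: eq_bigr => i _; apply: eq_bigr => j _; rewrite !mxE expr2.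
Qed.

(** Each link costs a factor 2 and each site belongs to at most two links, whence the 4. *)
Lemma chain_diff_le n p (a : 'I_n -> 'cV[R]_p) :
  \sum_(i < n) \sum_(j < n | j == i.+1 :> nat) dot (a i - a j) (a i - a j)
  <= 4 * \sum_i dot (a i) (a i).
Proof.
case: n a => [|n] a; first by rewrite !big_ord0 mulr0.
rewrite (sum_consecutive (fun i j => dot (a i - a j) (a i - a j))).
have le2 (u v : 'cV[R]_p) : dot (u - v) (u - v) <= 2 * (dot u u + dot v v).
  by have := dot_ge0 (u + v); rewrite !dotE; lra.
rewrite (le_trans (ler_sum _ (fun k _ => le2 _ _)))// -mulr_sumr big_split /=.
have le1 : \sum_(k < n)
    dot (a (widen_ord (leqnSn n) k)) (a (widen_ord (leqnSn n) k))
    <= \sum_i dot (a i) (a i) by rewrite big_ord_recr lerDl dot_ge0.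
have le1' : \sum_(k < n)
    dot (a (lift ord0 k)) (a (lift ord0 k))
    <= \sum_i dot (a i) (a i) by rewrite big_ord_recl lerDr dot_ge0.
by lra.
Qed.

End Chain.

(** * Block coordinates of configurations *)

Section Blocks.
Variables (R : realType) (N p : nat).
Implicit Types x y : 'cV[R]_(N * p).

Lemma blkE x i k : blk x i k 0 = x (mxvec_index i k) 0.
Proof. by rewrite !mxE. Qed.

Lemma blkD x y i : blk (x + y) i = blk x i + blk y i.
Proof. by apply/colP => k; rewrite !(blkE, mxE). Qed.

Lemma blkN x i : blk (- x) i = - blk x i.
Proof. by apply/colP => k; rewrite !(blkE, mxE). Qed.

(** Registered as a linear map, so that each link energy is [F] composed with a linear map. *)
Definition blk_diff i j x := blk x i - blk x j.

Lemma blk_diff_is_linear i j : linear (blk_diff i j).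
Proof. by move=> a x y; apply/colP => k; rewrite !(blkE, mxE); ring. Qed.

HB.instance Definition _ i j := GRing.isLinear.Build R 'cV[R]_(N * p) 'cV[R]_p _
  (blk_diff i j) (@blk_diff_is_linear i j).

Lemma blk_flat (f : 'I_N -> 'cV[R]_p) i : blk (flat f) i = f i.
Proof. by apply/colP => k; rewrite blkE mxE mxvecE !mxE. Qed.

Lemma blk_inj x y : (forall i, blk x i = blk y i) -> x = y.
Proof.
move=> E; apply/colP => l; case/mxvec_indexP: l => i k.
by rewrite -!blkE E.
Qed.

Lemma dot_blk x y : dot x y = \sum_i dot (blk x i) (blk y i).
Proof.
rewrite dot_sum (reindex _ (curry_mxvec_bij _ _)) /=.
under [RHS]eq_bigr do rewrite dot_sum.
rewrite pair_big; apply: eq_bigr => -[i k] _ /=.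
by rewrite !blkE.
Qed.

End Blocks.

(** * The projector [Pi] and the partial isometry [Q] *)

Section Centering.
Variables (R : realType) (N p : nat).
Hypothesis N_gt0 : (0 < N)%N.
Implicit Types x y w : 'cV[R]_(N * p).

Lemma sum_blk_Pi x : \sum_i blk (Pi x) i = 0.
Proof.
under eq_bigr do rewrite blk_flat.
rewrite sumrB sumr_const card_ord /barycenter -scaler_nat scalerA.
by rewrite mulfV ?pnatr_eq0 -?lt0n// scale1r subrr.
Qed.

Lemma PiD x y : Pi (x + y) = Pi x + Pi y.
Proof.
apply: blk_inj => i; rewrite blkD !blk_flat /barycenter !blkD.
under eq_bigr do rewrite blkD.
by rewrite big_split scalerDr /= addrACA opprD.
Qed.

Lemma blk_barycenter x i : blk (x - Pi x) i = barycenter x.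
Proof. by rewrite blkD blkN blk_flat opprB addrC subrK. Qed.

(** All blocks of [x - Pi x] equal the barycenter. Hence this complement also lies in the kernel of
    [Q]. *)
Lemma Pi_idem_compl x : Pi (x - Pi x) = 0.
Proof.
apply: blk_inj => i; rewrite blk_flat blk_barycenter.
rewrite [X in _ - X]/barycenter; under eq_bigr do rewrite blk_barycenter.
rewrite sumr_const card_ord -(scaler_nat _ (barycenter x)) scalerA
  mulVf ?pnatr_eq0 -?lt0n//.
by rewrite scale1r subrr; apply/colP => k; rewrite blkE !mxE.
Qed.

Lemma dot_Pi_compl x y : dot (Pi x) (y - Pi y) = 0.
Proof.
rewrite dot_blk; under eq_bigr do rewrite blk_barycenter dotC.
by rewrite -dot_sumr sum_blk_Pi dot0r.
Qed.

Variable Q : 'M[R]_(N.-1 * p, N * p).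
Hypothesis hQ : centering_matrix Q.

Lemma centering_dot x y : dot (Q *m Pi x) (Q *m Pi y) = dot (Pi x) (Pi y).
Proof.
have iso w : dot (Q *m Pi w) (Q *m Pi w) = dot (Pi w) (Pi w).
  by rewrite -!sqr_enorm (centering_isometry hQ)//; exists w.
rewrite (dot_polarization (Q *m Pi x)) (dot_polarization (Pi x)).
by rewrite -mulmxDr -PiD (iso (x + y)) (iso x) (iso y).
Qed.

(** Tested against [w], split as [Pi w] plus [w - Pi w]: the second part is killed by [Q] and
    orthogonal to the image of [Pi]. *)
Lemma centering_tr x : Q^T *m (Q *m Pi x) = Pi x.
Proof.
apply: dot_inj => w; rewrite -dot_mulmx -[w in LHS](subrK (Pi w)) mulmxDr.
rewrite (proj2 (centering_ker hQ _) (Pi_idem_compl w)) add0r centering_dot.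
by rewrite -[w in RHS](subrK (Pi w)) dotDr dot_Pi_compl add0r.
Qed.

Implicit Type z : 'cV[R]_(N.-1 * p).

(** Surjectivity of [Q] on the image of [Pi] shows that [Q^T] takes values in mean-zero
    configurations and is a right inverse of [Q]. *)
Lemma centering_trP z : exists2 x, Q^T *m z = Pi x & Q *m Pi x = z.
Proof.
have [_ [x _ <-] <-] := centering_onto hQ z.
by exists x; rewrite ?centering_tr.
Qed.

Lemma centering_mul_tr z : Q *m (Q^T *m z) = z.
Proof. by have [x -> ->] := centering_trP z. Qed.

Lemma dot_centering_tr z : dot (Q^T *m z) (Q^T *m z) = dot z z.
Proof. by rewrite -dot_mulmx centering_mul_tr. Qed.

Lemma sum_blk_centering_tr z : \sum_i blk (Q^T *m z) i = 0.
Proof. by have [x -> _] := centering_trP z; exact: sum_blk_Pi. Qed.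

End Centering.

(** * Hessian bounds and contraction *)

Section HessianBounds.
Variables (R : realType) (p : nat) (F : 'cV[R]_p -> R) (kappa : R).
Hypotheses (F_smooth : smooth F) (F_bounded_hess : bounded_hess F).
Hypothesis F_convex : forall x, mxle kappa%:M (hess F x).

Lemma hess_le_norm x u : dot u (hess F x *m u) <= hess_norm F * dot u u.
Proof.
rewrite (le_trans (dot_le_opnorm _ _))// ler_wpM2r ?dot_ge0//.
apply: sup_upper_bound; last by exists x.
by split=> //; exists (opnorm (hess F x)), x.
Qed.

(** As [1 <= p], the constant vector 1 is a nonzero test vector. The bound makes [Lambda] positive
    and yields [lambda <= Lambda]. *)
Lemma convexity_le_hess_norm : (1 <= p)%N -> kappa <= hess_norm F.
Proof.
move=> hp; pose u : 'cV[R]_p := const_mx 1.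
have u0 : 0 < dot u u.
  apply: dot_gt0; apply/eqP => /colP/(_ (Ordinal hp))/eqP.
  by rewrite !mxE oner_eq0.
rewrite -(ler_pM2r u0) -dot_scalar_mx (le_trans (F_convex 0 u))//.
exact: hess_le_norm.
Qed.

Lemma chain_potentialE N : @chain_potential R N p F =
  \sum_(i < N) \sum_(j < N | j == i.+1 :> nat) (F \o blk_diff i j).
Proof.
by apply/funext => x; rewrite fct_sumE; apply: eq_bigr => i _; rewrite fct_sumE.
Qed.

Lemma smooth_chain N : smooth (@chain_potential R N p F).
Proof.
rewrite chain_potentialE; apply: smooth_bigsum => i; apply: smooth_bigsum => j.
exact: smooth_comp_linear.
Qed.

Lemma dot_hess_chain N (x u : 'cV[R]_(N * p)) :
  dot u (hess (@chain_potential R N p F) x *m u) =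
  \sum_(i < N) \sum_(j < N | j == i.+1 :> nat)
    dot (blk_diff i j u) (hess F (blk_diff i j x) *m blk_diff i j u).
Proof.
have sF i j : smooth (F \o @blk_diff R N p i j) by exact: smooth_comp_linear.
rewrite (dot_hess _ _ _ (@smooth_chain N)) chain_potentialE.
have sD (i : 'I_N) :
    smooth (\sum_(j < N | j == i.+1 :> nat) (F \o @blk_diff R N p i j)).
  exact: smooth_bigsum.
rewrite derive_bigsum_fun// derive_bigsum => [|i]; last exact: smooth_derive.
apply: eq_bigr => i _; rewrite derive_bigsum_fun//.
rewrite derive_bigsum => [|j]; last exact: smooth_derive.
by apply: eq_bigr => j _;
  rewrite derive_comp_linear_fun (dot_hess _ _ _ F_smooth) -derive_comp_linear.
Qed.

Variables (N : nat) (Q : 'M[R]_(N.-1 * p, N * p)).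
Hypotheses (hN : (2 <= N)%N) (hQ : centering_matrix Q).
Notation Uc := (centered_potential F Q).

Lemma smooth_centered : smooth Uc.
Proof. exact: (smooth_comp_linear (mulmx Q^T) (@smooth_chain N)). Qed.

Lemma derive_centered u x :
  'D_u Uc x = 'D_(Q^T *m u) (@chain_potential R N p F) (Q^T *m x).
Proof. exact: (derive_comp_linear _ (mulmx Q^T)). Qed.

Lemma dot_hess_centered x u :
  dot u (hess Uc x *m u) =
  dot (Q^T *m u) (hess (@chain_potential R N p F) (Q^T *m x) *m (Q^T *m u)).
Proof.
rewrite (dot_hess _ _ _ smooth_centered) (dot_hess _ _ _ (@smooth_chain N)).
by rewrite (derive_comp_linear_fun _ (mulmx Q^T));
  exact: (derive_comp_linear _ (mulmx Q^T)).
Qed.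

Lemma hess_centered_le x : 0 <= hess_norm F ->
  mxle (hess Uc x) (4 * hess_norm F)%:M.
Proof.
move=> h0 u; rewrite dot_scalar_mx dot_hess_centered dot_hess_chain.
rewrite -(dot_centering_tr (ltnW hN) hQ) (dot_blk (Q^T *m u)).
rewrite [4 * _]mulrC -mulrA.
apply: le_trans (ler_wpM2l h0 (chain_diff_le (blk (Q^T *m u)))).
rewrite mulr_sumr ler_sum// => i _; rewrite mulr_sumr ler_sum// => j _.
exact: hess_le_norm.
Qed.

Lemma hess_centered_ge x : 0 <= kappa ->
  mxle (kappa / N%:R ^+ 2)%:M (hess Uc x).
Proof.
move=> k0 u; rewrite dot_scalar_mx dot_hess_centered dot_hess_chain.
rewrite -(dot_centering_tr (ltnW hN) hQ) (dot_blk (Q^T *m u)).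
have N0 : 0 < N%:R ^+ 2 :> R by rewrite exprn_gt0// ltr0n ltnW.
(* The middle term is the sum of squared link differences weighted by [kappa]: the Poincare
   inequality applies because [Q^T *m u] has zero mean, and convexity of [F] compares each link with
   its Hessian. *)
rewrite -mulrA; apply: (@le_trans _ _ (kappa *
    \sum_(i < N) \sum_(j < N | j == i.+1 :> nat)
      dot (blk_diff i j (Q^T *m u)) (blk_diff i j (Q^T *m u)))).
  rewrite ler_wpM2l// ler_pdivrMl//; apply: chain_poincare_col.
exact: (sum_blk_centering_tr (ltnW hN) hQ u).

rewrite mulr_sumr ler_sum// => i _; rewrite mulr_sumr ler_sum// => j _.
by rewrite -dot_scalar_mx; exact: F_convex.
Qed.

(** The chain rule makes the force in the drift a gradient, so its Jacobian is a symmetric Hessian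
    up to sign. *)
Lemma grad_centered x :
  Q *m grad (@chain_potential R N p F) (Q^T *m x) = grad Uc x.
Proof.
apply/colP => i; rewrite !mxE derive_centered.
rewrite (derive_sum_basis _ (smooth_differentiable _ (@smooth_chain N))).
by apply: eq_bigr => j _; rewrite -colE !mxE.
Qed.

Lemma centered_driftE gamma z : centered_drift F Q gamma z =
  col_mx (dsubmx z) (- grad Uc (usubmx z) - gamma *: dsubmx z).
Proof. by rewrite /centered_drift grad_centered. Qed.

Lemma is_derive_centered_drift gamma z w i :
  is_derive z w (fun z' => centered_drift F Q gamma z' i 0)
    ((col_mx (dsubmx w)
       (- (hess Uc (usubmx z) *m usubmx w) - gamma *: dsubmx w)) i 0).
Proof.
under eq_fun do rewrite centered_driftE.
case: (split_ordP i) => k ->.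
  under eq_fun do rewrite col_mxEu mxE.
  by rewrite col_mxEu mxE; exact: is_derive_coord.
pose e := basis_vec R k; have sU := smooth_centered.
pose f1 (z' : 'cV[R]_(N.-1 * p + N.-1 * p)) : R := 'D_e Uc (usubmx z').
pose f2 (z' : 'cV[R]_(N.-1 * p + N.-1 * p)) := z' (rshift (N.-1 * p) k) 0 : R.
have E h : f1 (h *: w + z) = 'D_e Uc (h *: usubmx w + usubmx z).
  by rewrite /f1 linearD linearZ.
have d1 : is_derive z w f1 ((hess Uc (usubmx z) *m usubmx w) k 0).
  split.
    apply: (@eq_line_derivable _ _ _ _ ('D_e Uc) _ _ _ _ E).
    apply: diff_derivable.
    by apply: smooth_differentiable; exact: smooth_derive.
  rewrite (@eq_line_derive _ _ _ _ ('D_e Uc) _ _ _ _ E).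
  (* Exchanging derivatives puts [e] outside, so that the value reads as entry [k] of the Hessian
     applied to [usubmx w]. *)
  rewrite derive_comm.
  - by rewrite -dot_hess// /e /basis_vec /dot trmx_delta -rowE mxE.
  - by move=> y; exact: smooth_differentiable.
  - by apply: smooth_differentiable; exact: smooth_derive.
  - by apply: smooth_differentiable; exact: smooth_derive.
have d2 : is_derive z w f2 (dsubmx w k 0).
  by rewrite mxE; exact: is_derive_coord.
have : is_derive z w (- f1 - gamma *: f2)
    (- (hess Uc (usubmx z) *m usubmx w) k 0 - gamma *: dsubmx w k 0).
  by apply: is_deriveB.
rewrite col_mxEd; congr is_derive; last by rewrite !mxE.
by apply/funext => z'; rewrite col_mxEd !mxE.
Qed.

Lemma jac_centered_drift gamma z : jac (centered_drift F Q gamma) z =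
  block_mx 0 1%:M (- hess Uc (usubmx z)) (- gamma%:M).
Proof.
apply/matrixP => i j; rewrite mxE.
rewrite (@derive_val _ _ _ _ _ _ _ (is_derive_centered_drift gamma z _ i)).
transitivity ((block_mx 0 1%:M (- hess Uc (usubmx z)) (- gamma%:M)
    *m basis_vec R j) i 0); last by rewrite -colE mxE.
rewrite -[in RHS](vsubmxK (basis_vec R j)) mul_block_col !mulNmx !mul_scalar_mx.
by rewrite mul0mx add0r scale1r.
Qed.

End HessianBounds.

(** * The twisted metric on phase space and its contraction *)

Lemma dot_col_mx (R : realType) m n (a c : 'cV[R]_m) (b d : 'cV[R]_n) :
  dot (col_mx a b) (col_mx c d) = dot a c + dot b d.
Proof. by rewrite /dot tr_col_mx mul_row_col mxE. Qed.

Section TwistedMetric.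
Variables (R : realType) (n : nat).

(** Matrix of the form [|x|^2 + 2 s x.y + t |y|^2]; the coupling [s] is what produces decay in the
    position. *)
Definition twisted_metric (s t : R) : 'M[R]_(n + n) :=
  block_mx 1%:M s%:M s%:M t%:M.

Lemma dot_twisted s t (w1 w2 v1 v2 : 'cV[R]_n) :
  dot (col_mx w1 w2) (twisted_metric s t *m col_mx v1 v2) =
  dot w1 v1 + s * (dot w1 v2 + dot w2 v1) + t * dot w2 v2.
Proof.
by rewrite mul_block_col dot_col_mx !mul_scalar_mx scale1r !dotE; ring.
Qed.

Lemma twisted_metric_sym s t : (twisted_metric s t)^T = twisted_metric s t.
Proof. by rewrite tr_block_mx !tr_scalar_mx. Qed.

(** The squares of [w1 + 2 s w2] and [w1 - 2 s w2] bound the cross term [2 s w1.w2] by half of [E]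
    once [4 s^2 <= t]. *)
Lemma twisted_metric_bounds s t (w1 w2 : 'cV[R]_n) : 4 * s ^+ 2 <= t ->
  let E := dot w1 w1 + t * dot w2 w2 in
  let m := dot (col_mx w1 w2) (twisted_metric s t *m col_mx w1 w2) in
  1 / 2 * E <= m <= 3 / 2 * E.
Proof.
move=> st /=; rewrite dot_twisted.
have := dot_ge0 (w1 - (2 * s) *: w2); have := dot_ge0 (w1 + (2 * s) *: w2).
have := ler_wpM2r (dot_ge0 w2) st; rewrite !dotE (dotC w2 w1).
set X := dot w1 w1; set Y := dot w2 w2; set Z := dot w1 w2 => ? ? ?.
by apply/andP; split; lra.
Qed.

(** Write [X], [Y] for the squared norms of [w1], [w2], and [h = w1.Hw1], [g = w2.Hw1]. As
    [gamma * s = 1] cancels [w1.w2], it suffices that [lambda s (X + t Y) / 2 <= s h - s Y + t g +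
    gamma t Y]. *)
Lemma twisted_metric_contraction (s t gamma lambda : R) (H : 'M[R]_n)
    (w1 w2 : 'cV[R]_n) :
  H^T = H -> 0 < t -> 0 < s -> gamma * s = 1 -> 4 * s ^+ 2 <= t ->
  0 < lambda -> lambda * t <= 1 -> mxle lambda%:M H -> mxle H (t^-1)%:M ->
  dot (col_mx w1 w2)
    (twisted_metric s t *m col_mx w2 (- (H *m w1) - gamma *: w2)) <=
  - (lambda * s / 3) *
    dot (col_mx w1 w2) (twisted_metric s t *m col_mx w1 w2).
Proof.
move=> Hs t0 s0 gs st l0 lt lH Ht.
have /= /andP[_ M_le] := twisted_metric_bounds w1 w2 st.
have ls0 : 0 <= lambda * s / 3 by rewrite divr_ge0 ?mulr_ge0 ?ltW.
(* The upper bound [3 / 2] on the metric turns the rate factor [1 / 3] into [1 / 2]. *)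
rewrite mulNr lerNr (le_trans (ler_wpM2l ls0 M_le))// dot_twisted !dotE.
have H0 : mxle 0%:M H.
  move=> u; apply: le_trans (lH u); rewrite !dot_scalar_mx mul0r.
  by rewrite mulr_ge0 ?dot_ge0 ?ltW.
have tG : t * dot (H *m w1) (H *m w1) <= dot w1 (H *m w1).
  by rewrite -ler_pdivlMl// dot_mulmx_le ?invr_gt0.
have := lH w1; rewrite dot_scalar_mx => lX.
have := dot_ge0 (H *m w1 + gamma *: w2); rewrite !dotE (dotC _ w2) => Hg.
have Y0 := dot_ge0 w2.
move: tG lX Hg Y0; set G := dot (H *m w1) _; set h := dot w1 (H *m w1).
set X := dot w1 w1; set Y := dot w2 w2; set Z := dot w1 w2; set g := dot w2 _.
move=> tG lX Hg Y0; clearbody G h X Y Z g.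
have g0 : 0 < gamma by rewrite -(pmulr_lgt0 _ s0) gs.
(* Young's inequality for the cross term [t * g]: the square of [H w1 + gamma w2], scaled by
   [t * s / 2] and simplified with [gamma * s = 1]. *)
have {}Hg : 0 <= s * t * G / 2 + t * g + gamma * t * Y / 2.
  have -> : s * t * G / 2 + t * g + gamma * t * Y / 2 =
     t * s / 2 * (G + gamma * g + gamma * (g + gamma * Y)).
    have -> : t * g = gamma * s * t * g by rewrite gs mul1r.
    have -> : gamma * t * Y / 2 = gamma * s * (gamma * t * Y / 2)
      by rewrite gs mul1r.
    by field.
  by rewrite mulr_ge0 ?divr_ge0 ?mulr_ge0 ?(ltW t0) ?(ltW s0).
have sg : 4 * s <= gamma * t.
  have := ler_wpM2l (ltW g0) st.
  have -> : gamma * (4 * s ^+ 2) = 4 * (gamma * s) * s by ring.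
  by rewrite gs mulr1.
have sgY := ler_wpM2r Y0 sg.
have stG : s * (t * G) <= s * h by rewrite ler_pM2l.
have slX : s * (lambda * X) <= s * h by rewrite ler_pM2l.
have lsY : lambda * s * t * Y <= gamma * t * Y / 4.
  have lts : lambda * t * (4 * s * Y) <= gamma * t * Y.
    rewrite (le_trans _ sgY)// ler_piMl// mulr_ge0// mulr_ge0// ltW//.
  by lra.
have gtY : 0 <= gamma * t * Y by rewrite !mulr_ge0 ?(ltW g0) ?(ltW t0).
have gsZ : s * (gamma * Z) = Z by rewrite mulrA (mulrC s) gs mul1r.
(* Half of [s h] absorbs the [G] term and the other half gives [lambda s X / 2]. Of [gamma t Y], one
   half goes to Young's inequality, a quarter to [s Y] and an eighth to [lambda s t Y / 2]. *)
by lra.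
Qed.

End TwistedMetric.

Theorem proposition7 (R : realType) (p : nat) (F : 'cV[R]_p -> R) (kappa : R)
    (hp : (1 <= p)%N)
    (F_smooth : smooth F)
    (F_even : forall x, F (- x) = F x)
    (F_bounded_hess : bounded_hess F)
    (kappa_gt0 : 0 < kappa)
    (F_convex : forall x, mxle kappa%:M (hess F x)) :
  let Lambda := 4 * hess_norm F in
  (forall (N : nat) (Q : 'M[R]_(N.-1 * p, N * p)),
     (2 <= N)%N -> centering_matrix Q ->
     let lambda := kappa / N%:R ^+ 2 in
     forall x : 'cV[R]_(N.-1 * p),
       mxle lambda%:M (hess (centered_potential F Q) x) /\
       mxle (hess (centered_potential F Q) x) Lambda%:M) /\
  (forall gamma : R, 2 * Num.sqrt Lambda <= gamma ->
   forall (N : nat) (Q : 'M[R]_(N.-1 * p, N * p)),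
     (2 <= N)%N -> centering_matrix Q ->
     let rho := kappa / (3 * gamma * N%:R ^+ 2) in
     exists M : 'M[R]_(N.-1 * p + N.-1 * p),
       [/\ sym_posdef M,
           ContR (centered_drift F Q gamma) M rho,
           mxle (1 / 2 * Num.min 1 Lambda^-1)%:M M &
           mxle M (3 / 2 * Num.max 1 Lambda^-1)%:M]).
Proof.
move=> Lambda; have kF := convexity_le_hess_norm F_bounded_hess F_convex hp.
have h0 : 0 <= hess_norm F by rewrite (le_trans (ltW kappa_gt0)).
have bounds N (Q : 'M[R]_(N.-1 * p, N * p)) (hN : (2 <= N)%N)
    (hQ : centering_matrix Q) x :
    mxle (kappa / N%:R ^+ 2)%:M (hess (centered_potential F Q) x) /\
    mxle (hess (centered_potential F Q) x) Lambda%:M.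
  split; first by apply: hess_centered_ge => //; exact: ltW.
  exact: hess_centered_le.
split=> [N Q hN hQ lambda x|gamma hgamma N Q hN hQ rho]; first exact: bounds.
have L0 : 0 < Lambda by rewrite mulr_gt0// (lt_le_trans kappa_gt0).
have g0 : 0 < gamma by rewrite (lt_le_trans _ hgamma)// mulr_gt0 ?sqrtr_gt0.
(* The friction threshold, squared: it becomes the condition [4 s^2 <= t] for [s = 1 / gamma] and
   [t = 1 / Lambda]. *)
have g2 : 4 * Lambda <= gamma ^+ 2.
  have -> : 4 * Lambda = (2 * Num.sqrt Lambda) ^+ 2.
    by rewrite exprMn sqr_sqrtr ?ltW// -natrX.
  by rewrite ler_pXn2r// nnegrE ?mulr_ge0 ?sqrtr_ge0 ?(ltW g0).
have L'0 : 0 < Lambda^-1 by rewrite invr_gt0.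
have st : 4 * gamma^-1 ^+ 2 <= Lambda^-1.
  rewrite exprVn ler_pdivrMr ?exprn_gt0// ler_pdivlMl// mulrC.
  exact: g2.
have N2 : 1 <= N%:R ^+ 2 :> R by rewrite -natrX ler1n expn_gt0 ltnW.
have l0 : 0 < kappa / N%:R ^+ 2 by rewrite divr_gt0// (lt_le_trans ltr01).
have lL : kappa / N%:R ^+ 2 * Lambda^-1 <= 1.
  rewrite ler_pdivrMr// mul1r (le_trans (_ : _ <= kappa))//.
    by rewrite ler_pdivrMr ?ler_peMr ?(lt_le_trans ltr01)// ltW.
  by rewrite (le_trans kF)// /Lambda; lra.
exists (twisted_metric _ gamma^-1 Lambda^-1).
have M_bounds (w : 'cV[R]_(N.-1 * p + N.-1 * p)) :=
  twisted_metric_bounds (usubmx w) (dsubmx w) st.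
have dotw (w : 'cV[R]_(N.-1 * p + N.-1 * p)) :
    dot w w = dot (usubmx w) (usubmx w) + dot (dsubmx w) (dsubmx w).
  by rewrite -dot_col_mx vsubmxK.
(* Besides being one of the claims, this bound gives positive definiteness. *)
have lower : mxle (1 / 2 * Num.min 1 Lambda^-1)%:M
    (twisted_metric (N.-1 * p) gamma^-1 Lambda^-1).
  move=> w; have /= /andP[M_ge _] := M_bounds w; rewrite vsubmxK in M_ge.
  apply: le_trans M_ge; rewrite dot_scalar_mx -(mulrA (1 / 2)).
  rewrite ler_pM2l ?divr_gt0// dotw.
  rewrite mulrDr lerD//.
    by rewrite ler_piMl ?dot_ge0// ge_min lexx.
  by rewrite ler_wpM2r ?dot_ge0// ge_min lexx orbT.
split=> //.
- split=> [|w w0]; first exact: twisted_metric_sym.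
  apply: lt_le_trans (lower w); rewrite dot_scalar_mx mulr_gt0 ?dot_gt0//.
  by rewrite mulr_gt0 ?divr_gt0// lt_min ltr01.
- move=> z w; rewrite -mulmxA jac_centered_drift//.
  have [lH HL] := bounds N Q hN hQ (usubmx z).
  rewrite mulNmx -scalemxAl dotNr dotZr -mulNr -(vsubmxK w) mul_block_col.
  rewrite mul0mx add0r mul1mx !mulNmx mul_scalar_mx.
  (* Here [rho] is recognised as [lambda * s / 3] with [s = 1 / gamma]. *)
  have -> : - rho = - (kappa / N%:R ^+ 2 * gamma^-1 / 3).
    by rewrite /rho; field; rewrite pnatr_eq0 -lt0n (ltnW hN) gt_eqF.
  apply: twisted_metric_contraction; rewrite ?invrK ?invr_gt0//.
    by apply: hess_sym; exact: smooth_centered.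
  by rewrite mulfV ?gt_eqF.
- move=> w; have /= /andP[_ M_le] := M_bounds w; rewrite vsubmxK in M_le.
  apply: le_trans M_le _; rewrite dot_scalar_mx -(mulrA (3 / 2)).
  rewrite ler_pM2l ?divr_gt0// dotw.
  rewrite mulrDr lerD//.
    by rewrite ler_peMl ?dot_ge0// le_max lexx.
  by rewrite ler_wpM2r ?dot_ge0// le_max lexx orbT.
Qed.
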